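(* For $(\chi,\eta)\in\mathcal{D}$, the complex slope $\Omega(\chi,\eta)$ is the only solution in the (open) upper half plane of the algebraic equation $$\Omega\cdot\prod_{i=1}^k\big((a_i-\chi+1-\eta)\Omega-(a_i-\chi)\big)=\prod_{i=1}^k\big((b_i-\chi+1-\eta)\Omega-(b_i-\chi)\big).$$ The slope $\Omega(\chi,\eta)$ also satisfies, in $\mathcal{D}$, the differential equation (complex Burgers equation) $$\Omega(\chi,\eta)\frac{\partial\Omega(\chi,\eta)}{\partial\chi}=-(1-\Omega(\chi,\eta))\frac{\partial\Omega(\chi,\eta)}{\partial\eta}.$$
   Context: Fix $k\ge2$ and reals $a_1<b_1<\dots<a_k<b_k$ with $\sum_i(b_i-a_i)=1$. The limiting polygon $\mathcal{P}$ has interior $\{(\chi,\eta):0<\eta<1,\ a_1+1-\eta<\chi<b_k,\ \text{and for no } i:\ a_i+1-\eta\le\chi\le b_i\}$. Liquid region: $\mathcal{D}$ is the set of $(\chi,\eta)$ inside $\mathcal{P}$ for which the equation $(w-\chi)\prod_{i=1}^k(w-a_i)=(w-\chi+1-\eta)\prod_{i=1}^k(w-b_i)$ has a nonreal solution $w$. Complex slope: for each $N$ let $A_i(N)=[a_iN]+\frac12+\delta_i$, $B_i(N)=[b_iN]+\frac12+\delta_i'$ with $\delta_i,\delta_i'\in\{-1,0,1\}$ such that $\sum_i(B_i(N)-A_i(N))=N$, and consider the uniform probability measure on integer arrays $\{\mathsf{x}^m_j:1\le j\le m\le N\}$ with $\mathsf{x}^m_{j+1}<\mathsf{x}^{m-1}_j\le\mathsf{x}^m_j$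 and top row $\bigcup_i\{A_i(N)+\frac12,\dots,B_i(N)-\frac12\}$ (uniform lozenge tilings of a $3k$-gon). Let $\rho_s$ be its correlation functions: $\rho_s(x_1,n_1;\dots;x_s,n_s)$ is the probability that each $(x_i,n_i)$ equals some $(\mathsf{x}^m_j,m)$. The complex slope $\Omega=\Omega(\chi,\eta)$ is the parameter of the local limit at $(\chi,\eta)$: $\rho_s(x_1(N),n_1(N);\dots)\to\det[\mathsf{B}_\Omega(n_i-n_j;x_j-x_i)]_{i,j=1}^s$ whenever $x_i(N)/N\to\chi$, $n_i(N)/N\to\eta$ and the differences $x_i(N)-x_j(N)$, $n_i(N)-n_j(N)$ converge to integers $x_i-x_j$, $n_i-n_j$. Here $\mathsf{B}_\Omega(m,l)=\frac{1}{2\pi\mathrm{i}}\int_{\bar\Omega}^{\Omega}(1-u)^mu^{-l-1}du$, with path crossing $(0,1)$ for $m\ge0$ and $(-\infty,0)$ for $m<0$. (In the liquid region this slope is given by $\Omega=\frac{\mathsf{w}_c-\chi}{\mathsf{w}_c-\chi+1-\eta}$, where $\mathsf{w}_c$ is the solution in the upper half plane of the equation defining $\mathcal{D}$.) *)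

(* Defs.v *)
From HB Require Import structures.
From mathcomp Require Import all_boot all_order all_algebra.
From mathcomp Require Import finmap.
From mathcomp Require Import all_classical all_reals all_analysis.
From mathcomp Require Export complex.

Set Implicit Arguments.
Unset Strict Implicit.
Unset Printing Implicit Defensive.

Import Order.TTheory GRing.Theory Num.Theory.
Import numFieldNormedType.Exports.
Local Open Scope classical_set_scope.
Local Open Scope complex_scope.
Local Open Scope ring_scope.

(* Families indexed by 1 <= i <= k are functions on nat whose values outside
   this range are never used.  A complex number z has parts complex.Re z and
   complex.Im z, and r%:C is the complex number with real part r. *)

Section Polygon.
Variables (R : realType) (k : nat) (a b : nat -> R).

Definition polygon_params : Prop :=
  [/\ forall i, (1 <= i <= k)%N -> a i < b i,
      forall i, (1 <= i < k)%N -> b i < a i.+1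
    & \sum_(1 <= i < k.+1) (b i - a i) = 1].

Definition in_polygon (chi eta : R) : Prop :=
  [/\ 0 < eta < 1, a 1%N + 1 - eta < chi < b k
    & ~ exists i, (1 <= i <= k)%N /\ a i + 1 - eta <= chi <= b i].

Definition critical_eq (chi eta : R) (w : R[i]) : Prop :=
  (w - chi%:C) * \prod_(1 <= i < k.+1) (w - (a i)%:C) =
  (w - chi%:C + 1 - eta%:C) * \prod_(1 <= i < k.+1) (w - (b i)%:C).

Definition liquid (chi eta : R) : Prop :=
  in_polygon chi eta /\
  exists w : R[i], complex.Im w != 0 /\ critical_eq chi eta w.

Definition slope_eq (chi eta : R) (z : R[i]) : Prop :=
  z * \prod_(1 <= i < k.+1) ((a i - chi + 1 - eta)%:C * z - (a i - chi)%:C) =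
  \prod_(1 <= i < k.+1) ((b i - chi + 1 - eta)%:C * z - (b i - chi)%:C).

End Polygon.

Section Tilings.
Variables (R : realType) (k : nat) (a b : nat -> R).
(* d N i and d' N i are the corrections in {-1, 0, 1} made for size N. *)
Variables (d d' : nat -> nat -> int).

Definition endA (N i : nat) : R :=
  (Num.floor (a i * N%:R))%:~R + 2^-1 + (d N i)%:~R.

Definition endB (N i : nat) : R :=
  (Num.floor (b i * N%:R))%:~R + 2^-1 + (d' N i)%:~R.

Definition valid_rounding : Prop :=
  (forall N i, (1 <= i <= k)%N ->
     d N i \in [:: -1; 0; 1] /\ d' N i \in [:: -1; 0; 1]) /\
  (forall N, \sum_(1 <= i < k.+1) (endB N i - endA N i) = N%:R).

Definition top_row (N : nat) : set int :=
  [set p | exists i, (1 <= i <= k)%N /\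
                     endA N i + 2^-1 <= p%:~R <= endB N i - 2^-1].

(* The entries x m j, 1 <= j <= m <= N, of an array are extended by 0, so that
   each array is represented by exactly one function. *)
Definition arrays (N : nat) : set (nat -> nat -> int) :=
  [set x | [/\ forall m j, ~~ [&& 1 <= j, j <= m & m <= N]%N -> x m j = 0,
               forall m j, [&& 1 <= j, j < m & m <= N]%N ->
                 x m j.+1 < x m.-1 j /\ x m.-1 j <= x m j
             & [set x N j | j in [set j | (1 <= j <= N)%N]] = top_row N]].

Definition unif_prob (T : choiceType) (A E : set T) : R :=
  (#|` fset_set (A `&` E)|)%:R / (#|` fset_set A|)%:R.

Definition correlation (N s : nat) (x : 'I_s -> int) (n : 'I_s -> nat) : R :=
  unif_prob (arrays N)
    [set X | forall i : 'I_s,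
       exists j, [&& 1 <= j, j <= n i & n i <= N]%N /\ X (n i) j = x i].

(* Integral of g over the segment from p to q. *)
Definition segment_int (g : R[i] -> R[i]) (p q : R[i]) : R[i] :=
  let h (t : R) := (q - p) * g (p + t%:C * (q - p)) in
  Rintegral lebesgue_measure `[0, 1] (fun t => complex.Re (h t)) +i*
  Rintegral lebesgue_measure `[0, 1] (fun t => complex.Im (h t)).

(* For Im z <> 0 the integrand is holomorphic away from 0 and 1 (away from 0
   when m >= 0), so the integral is the same for all paths with the prescribed
   crossing; the path used is the broken line through 1/2, resp. -1. *)
Definition beta_kernel (z : R[i]) (m l : int) : R[i] :=
  let g (u : R[i]) := (1 - u) ^ m * u ^ (- l - 1) in
  let c : R[i] := if 0 <= m then 2^-1 else -1 in
  ((2 * pi)%:C * ('i)%C)^-1 * (segment_int g (z^*)%C c + segment_int g c z).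

(* z is the parameter of the local limit at (chi, eta).  The points are
   pairwise distinct, as always for correlation functions (the determinant
   vanishes when two of them coincide).  No sign is imposed on Im z; it is
   only required that the path from z^* to z be nondegenerate. *)
Definition complex_slope (chi eta : R) (z : R[i]) : Prop :=
  complex.Im z != 0 /\
  forall (s : nat) (x : nat -> 'I_s -> int) (n : nat -> 'I_s -> nat)
         (y p : 'I_s -> int),
    (forall i, (x N i)%:~R / N%:R @[N --> \oo] --> chi) ->
    (forall i, (n N i)%:R / N%:R @[N --> \oo] --> eta) ->
    (forall i j,
       ((x N i - x N j)%:~R : R) @[N --> \oo] --> ((y i - y j)%:~R : R)) ->
    (forall i j, (((n N i)%:Z - (n N j)%:Z)%:~R : R) @[N --> \oo] -->
                 ((p i - p j)%:~R : R)) ->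
    (forall i j, i != j -> (y i, p i) != (y j, p j)) ->
    exists2 r : R,
      correlation N (x N) (n N) @[N --> \oo] --> r
      & r%:C = \det (\matrix_(i < s, j < s)
                       beta_kernel z (p i - p j) (y j - y i)).

End Tilings.

(* Derivative of a complex-valued function of a real variable. *)
Definition is_cderive (R : realType) (f : R -> R[i]) (t : R) (df : R[i]) :
    Prop :=
  is_derive t (1 : R) (fun u => complex.Re (f u)) (complex.Re df) /\
  is_derive t (1 : R) (fun u => complex.Im (f u)) (complex.Im df).

(* Main.v *)
Require Import Defs.
From HB Require Import structures.
From mathcomp Require Import all_boot all_order all_algebra.
From mathcomp Require Import all_classical all_reals all_analysis.
From mathcomp Require Import complex polyrcf ring lra.

(** If [w] solves the critical equation and
    [Omega = (w - chi) / (w - chi + 1 - eta)], each factor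
    [(c - chi + 1 - eta) * Omega - (c - chi)] is [w - c] times a constant
    independent of [c], so the equation for [Omega] is the critical one in
    disguise.

    The critical polynomial [P] has real coefficients, degree [k] and leading
    coefficient [eta].  The signs of [P (b i)] give a real root [x] with
    [b i < x <= b i.+1] for every [i] but the one with [b i <= chi < b i.+1],
    hence [k - 2] real roots; so [P] has at most one root in the upper half
    plane, and that root is simple.

    At perturbed parameters, the value of the critical polynomial at the old
    root is small, and its modulus is [eta] times the product of the distances
    to its roots, so one of them is near.  Since [P] is affine in the parameters
    along a line, the difference quotient of [w] is then an explicit continuous
    function of [w]. *)

Set Implicit Arguments.
Unset Strict Implicit.
Unset Printing Implicit Defensive.

Import Order.TTheory GRing.Theory Num.Theory.
Import numFieldNormedType.Exports.
Local Open Scope complex_scope.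
Local Open Scope ring_scope.

(** * The critical polynomial and its real roots *)

Section CriticalPolynomial.
Variables (R : realType) (k : nat) (a b : nat -> R).

Definition critical_poly (chi eta : R) : {poly R} :=
  ('X - chi%:P) * \prod_(1 <= i < k.+1) ('X - (a i)%:P) -
  ('X - (chi - 1 + eta)%:P) * \prod_(1 <= i < k.+1) ('X - (b i)%:P).

Local Notation critical_polyC chi eta :=
  (map_poly (real_complex R) (critical_poly chi eta)).

Lemma horner_critical_poly (chi eta x : R) :
  (critical_poly chi eta).[x] =
  (x - chi) * \prod_(1 <= i < k.+1) (x - a i) -
  (x - chi + 1 - eta) * \prod_(1 <= i < k.+1) (x - b i).
Proof.
rewrite /critical_poly !hornerE !horner_prod.
congr (_ * _ - _ * _); first by apply: eq_bigr => i _; rewrite !hornerE.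
- ring.
- by apply: eq_bigr => i _; rewrite !hornerE.
Qed.

Lemma horner_critical_polyC (chi eta : R) (w : R[i]) :
  (critical_polyC chi eta).[w] =
  (w - chi%:C) * \prod_(1 <= i < k.+1) (w - (a i)%:C) -
  (w - chi%:C + 1 - eta%:C) * \prod_(1 <= i < k.+1) (w - (b i)%:C).
Proof.
rewrite /critical_poly rmorphB !rmorphM /= !rmorph_prod /= !map_polyXsubC.
rewrite !hornerE.
rewrite !horner_prod; congr (_ * _ - _ * _).
- by apply: eq_bigr => i _ /=; rewrite !map_polyXsubC !hornerE.
- rewrite rmorphD rmorphB rmorph1; ring.
- by apply: eq_bigr => i _ /=; rewrite !map_polyXsubC !hornerE.
Qed.

Lemma critical_eqE (chi eta : R) (w : R[i]) :
  critical_eq k a b chi eta w <-> root (critical_polyC chi eta) w.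
Proof.
rewrite rootE horner_critical_polyC subr_eq0; split; first by move=> ->.
by move/eqP.
Qed.

Hypothesis hab : polygon_params k a b.

(** Both products are monic of degree [k + 1], so their top terms cancel. By Vieta the coefficient
    of degree [k] is [chi - 1 + eta] plus the sum of the [b i], minus [chi] and the sum of the
    [a i]; the total length 1 of the intervals leaves [eta]. *)
Lemma size_lead_coef_critical_poly (chi eta : R) : eta != 0 ->
  size (critical_poly chi eta) = k.+1 /\
  lead_coef (critical_poly chi eta) = eta.
Proof.
case: hab => _ _ hsum eta0.
pose s c (f : nat -> R) := c :: [seq f i | i <- index_iota 1 k.+1].
have szs c f : size (s c f) = k.+1 by rewrite /= size_map size_iota subSS subn0.
have prods c f : ('X - c%:P) * \prod_(1 <= i < k.+1) ('X - (f i)%:P) =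
    \prod_(p <- s c f) ('X - p%:P) by rewrite big_cons big_map.
have topc c f : (\prod_(p <- s c f) ('X - p%:P))`_k.+1 = 1.
  have /monicP := monic_prod_XsubC (s c f) predT id.
  by rewrite lead_coefE size_prod_XsubC szs.
have subc c f : (\prod_(p <- s c f) ('X - p%:P))`_k =
    - (c + \sum_(1 <= i < k.+1) f i).
  have := @coefPn_prod_XsubC _ (s c f); rewrite szs => -> //.
  by rewrite big_cons big_map.
have cP : (critical_poly chi eta)`_k = eta.
  rewrite /critical_poly !prods coefB !subc.
  by move: hsum; rewrite sumrB => hsum; lra.
have le_sz : (size (critical_poly chi eta) <= k.+1)%N.
  apply/leq_sizeP => j; rewrite leq_eqVlt => /predU1P[<-|ltj].
    by rewrite /critical_poly !prods coefB !topc subrr.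
  by rewrite /critical_poly !prods coefB !nth_default ?subrr //
    size_prod_XsubC szs.
have sz : size (critical_poly chi eta) = k.+1.
  apply/eqP; rewrite eqn_leq le_sz ltnNge; apply/negP => le_k.
  by move/eqP: eta0; apply; rewrite -[LHS]cP nth_default.
by rewrite lead_coefE sz.
Qed.

Lemma le_endpoints (i j : nat) : (1 <= i)%N -> (i < j)%N -> (j <= k)%N ->
  b i < a j /\ b i < b j.
Proof.
case: hab => lt_ab lt_ba _ i1; elim: j => // j IH.
rewrite ltnS leq_eqVlt => ij jk.
have aj := lt_ba j; have bj := lt_ab j.+1 jk.
case/predU1P: ij => [eij|ltij].
  have h : b i < a j.+1 by rewrite eij; apply: aj; rewrite -eij i1 eij.
  by split=> //; apply: lt_trans bj.
have [_ h] := IH ltij (ltnW jk).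
have h' : b i < a j.+1.
  by apply: lt_trans h _; apply: aj; rewrite (leq_trans i1 (ltnW ltij)).
by split=> //; apply: lt_trans bj.
Qed.

Lemma critical_poly_at_b (chi eta : R) (i : nat) : (1 <= i <= k)%N ->
  (critical_poly chi eta).[b i] =
  (b i - chi) * \prod_(1 <= j < k.+1) (b i - a j).
Proof.
move=> ik; rewrite horner_critical_poly [X in _ - _ * X](bigD1_seq i) /=.
- by rewrite subrr mul0r mulr0 subr0.
- by rewrite mem_index_iota.
- exact: iota_uniq.
Qed.

(* Passing from [b i] to [b i.+1], exactly one factor [b _ - a _], that of
   [a i.+1], changes sign. *)
Lemma critical_poly_root_between (chi eta : R) (i : nat) : (1 <= i < k)%N ->
  0 < (b i - chi) * (b i.+1 - chi) ->
  exists2 x, b i < x < b i.+1 & root (critical_poly chi eta) x.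
Proof.
case: hab => lt_ab lt_ba _ /andP[i1 ik] same_side.
have [_ lt_b] := le_endpoints i1 (ltnSn i) ik.
have [] := @poly_ivtoo _ (critical_poly chi eta) (b i) (b i.+1) (ltW lt_b).
  rewrite !critical_poly_at_b ?i1 ?(ltnW ik) //= mulrACA -big_split /=.
  rewrite pmulr_rlt0 // (bigD1_seq i.+1) /= ?iota_uniq //; last first.
    by rewrite mem_index_iota /= ltnS.
  rewrite pmulr_llt0.
    rewrite pmulr_llt0 ?subr_gt0 ?lt_ab //.
    by rewrite subr_lt0; apply: lt_ba; rewrite i1.
  rewrite big_seq_cond; apply: prodr_gt0 => j.
  rewrite mem_index_iota => /andP[/andP[j1 jk] ji].
  have [lt_ij|le_ji] := ltnP i.+1 j.
    have [h1 _] := le_endpoints (i := i.+1) isT lt_ij jk.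
    rewrite nmulr_rgt0 ?subr_lt0 //; exact: lt_trans h1.
  have {}le_ji : (j <= i)%N by rewrite -ltnS ltn_neqAle ji.
  have lt_abi : a j < b i.
    have lt_j : a j < b j by apply: lt_ab; rewrite j1.
    move: le_ji; rewrite leq_eqVlt => /predU1P[<- //|lt_ji].
    have [_ h] := le_endpoints j1 lt_ji (ltnW ik).
    exact: lt_trans h.
  by rewrite mulr_gt0 ?subr_gt0 // (lt_trans lt_abi).
by move=> x; rewrite in_itv; exists x.
Qed.

Lemma critical_poly_real_roots (chi eta : R) : in_polygon k a b chi eta ->
  exists rs : seq R, [/\ uniq rs, size rs = k.-2
    & all (root (critical_poly chi eta)) rs].
Proof.
case=> /andP[eta0 eta1] /andP[lt_a lt_chi] nin.
(* For [k = 0] the lengths would have the empty sum 0 instead of 1. *)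
have k0 : (0 < k)%N.
  case: k hab nin lt_chi => // -[_ _]; rewrite big_geq // => /esym/eqP.
  by rewrite oner_eq0.
(* As [chi] exceeds [a 1 + 1 - eta], staying outside the first cut forces it beyond [b 1]. *)
have b1 : b 1%N < chi.
  rewrite ltNge; apply/negP => le_chi; apply: nin; exists 1%N; split=> //.
  by rewrite (ltW lt_a).
pose pr j := (1 <= j < k)%N && (b j <= chi).
have k1 : (1 < k)%N.
  by rewrite ltn_neqAle k0 andbT; apply/eqP => k1; move: lt_chi b1;
     rewrite -k1 => /lt_trans h /h; rewrite ltxx.
have ex_pr : exists j, pr j by exists 1%N; rewrite /pr k1 /= ltW.
have pr_le j : pr j -> (j <= k)%N by case/andP=> /andP[_ /ltnW].
(* The largest such [j] locates [chi] in [[b j, b j.+1[], the one gap where a sign change may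
   fail. *)
case: (ex_maxnP ex_pr pr_le) => j /andP[/andP[j1 jk] bj] jmax.
have lt_bj : chi < b j.+1.
  have := jk; rewrite leq_eqVlt => /predU1P[->//|jk1].
  rewrite ltNge; apply/negP => h.
  by have := jmax j.+1; rewrite /pr jk1 h ltnn; move/(_ isT).
(* The gaps are taken half-open: they are pairwise disjoint, which keeps the roots distinct, yet
   they still contain the right endpoint needed when [chi] is itself some [b i.+1]. The value 0 is a
   default for the excluded indices. *)
have [r hr] : exists r : nat -> R, forall i, (1 <= i < k)%N -> i != j ->
    b i < r i <= b i.+1 /\ root (critical_poly chi eta) (r i).
  suff /choice[r hr] : forall i, exists x : R, (1 <= i < k)%N -> i != j ->
    b i < x <= b i.+1 /\ root (critical_poly chi eta) x by exists r.
  move=> i.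
  have [ik|] := boolP (1 <= i < k)%N; last by exists 0.
  have [->|nij] := eqVneq i j; first by exists 0.
  have /andP[i1 ik'] := ik.
  have between : 0 < (b i - chi) * (b i.+1 - chi) -> exists x : R,
      true -> true -> b i < x <= b i.+1 /\ root (critical_poly chi eta) x.
    case/(critical_poly_root_between eta ik) => x /andP[x1 x2] rx.
    by exists x; rewrite x1 ltW.
  have [lt_ij|le_ji] := ltnP i j.
    have [_ lt_ibj] := le_endpoints i1 lt_ij (ltnW jk).
    have lt_ib : b i < chi by apply: lt_le_trans bj.
    have le_bi1 : b i.+1 <= chi.
      apply: le_trans bj; move: lt_ij; rewrite leq_eqVlt => /predU1P[->//|h].
      by have [_ /ltW] := le_endpoints (i := i.+1) isT h (ltnW jk).
    move: le_bi1; rewrite le_eqVlt => /predU1P[bi1|lt_bi1]; last first.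
      by apply: between; rewrite nmulr_rgt0 subr_lt0.
    exists (b i.+1) => _ _; split.
      by rewrite lexx bi1 lt_ib.
    by rewrite rootE critical_poly_at_b ?ik' // bi1 subrr mul0r.
  have {}le_ji : (j < i)%N by rewrite ltn_neqAle eq_sym nij.
  have lt_ib : chi < b i.
    apply: lt_le_trans lt_bj _; move: le_ji.
    rewrite leq_eqVlt => /predU1P[->//|h].
    by have [_ /ltW] := le_endpoints (i := j.+1) isT h (ltnW ik').
  have [_ lt_bb] := le_endpoints i1 (ltnSn i) ik'.
  by apply: between; rewrite mulr_gt0 ?subr_gt0 // (lt_trans lt_ib).
(* There are [k - 1] gaps; dropping the one that contains [chi] leaves [k - 2]. *)
pose s := rem j (index_iota 1 k).
have s_uniq : uniq s by rewrite rem_uniq ?iota_uniq.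
have memsP i : i \in s -> (1 <= i < k)%N /\ i != j.
  by rewrite mem_rem_uniq ?iota_uniq // inE mem_index_iota => /andP[-> ->].
exists [seq r i | i <- s]; split.
- rewrite map_inj_in_uniq // => x y /memsP[xk xj] /memsP[yk yj] rxy.
  wlog lt_xy : x y xk xj yk yj rxy / (x < y)%N.
    move=> h; have [/h->//|/h h'|//] := ltngtP x y.
    by apply/esym/h'.
  have [/andP[_ rx] _] := hr x xk xj; have [/andP[ry _] _] := hr y yk yj.
  have le_b : b x.+1 <= b y.
    move: lt_xy; rewrite leq_eqVlt => /predU1P[->//|h].
    have /andP[_ /ltnW yk'] := yk.
    by have [_ /ltW] := le_endpoints (i := x.+1) isT h yk'.
  by have := le_lt_trans (le_trans rx le_b) ry; rewrite rxy ltxx.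
- rewrite size_map size_rem ?size_iota ?subn1 //.
  by rewrite mem_index_iota j1.
- by apply/allP => _ /mapP[i /memsP[ik ij] ->]; case: (hr i ik ij).
Qed.

(** The coefficients are real, so the conjugate of [w] is a root too. With the [k - 2] real roots
    this makes [k] distinct roots, as many as the degree, hence a complete splitting. *)
Lemma critical_polyC_factor (chi eta : R) (w : R[i]) :
  in_polygon k a b chi eta -> complex.Im w != 0 ->
  critical_eq k a b chi eta w -> (2 <= k)%N ->
  exists rs : seq R, critical_polyC chi eta = eta%:C *:
    (('X - w%:P) * (('X - (conjc w)%:P) * \prod_(r <- rs) ('X - (r%:C)%:P))).
Proof.
move=> inP imw /critical_eqE rw hk.
have [rs [urs szrs rrs]] := critical_poly_real_roots inP.
have eta0 : eta != 0 by case: inP => /andP[/lt0r_neq0].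
have [sz lc] := size_lead_coef_critical_poly chi eta0.
exists rs.
pose ws := [:: w, conjc w & [seq r%:C | r <- rs]].
rewrite (@all_roots_prod_XsubC _ (critical_polyC chi eta) ws).
- by rewrite lead_coef_map lc !big_cons big_map.
- by rewrite size_map_poly sz /= size_map szrs; case: k hk => [|[|]].
- rewrite /= rw -[X in root X _ && _]/(critical_polyC chi eta).
  have -> : root (critical_polyC chi eta) (conjc w).
    rewrite -complex_root_conj -map_poly_comp.
    by rewrite (eq_map_poly (g := real_complex R)) // => x /=; rewrite oppr0.
  rewrite all_map; apply/allP => r /(allP rrs) rr /=.
  by rewrite fmorph_root.
- rewrite uniq_rootsE /= inE negb_or map_inj_uniq ?urs ?andbT; last first.
    exact: complexI.
  have notin z : complex.Im z != 0 -> z \notin [seq r%:C | r <- rs].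
    by move=> imz; apply/mapP => -[r _ zr]; move: imz; rewrite zr eqxx.
  rewrite !notin ?andbT //.
    case: (w) imw => x y /= y0.
    by rewrite eq_complex /= eqxx /= -subr_eq0 opprK -mulr2n mulrn_eq0.
  by case: (w) imw => x y /=; rewrite oppr_eq0.
Qed.

End CriticalPolynomial.

(** * Critical roots and slopes in the upper half plane *)

(** In the splitting given by [w], the roots other than [w] are real or equal to its conjugate, so
    none of them lies in the upper half plane. *)
Lemma critical_eq_uniq (R : realType) (k : nat) (a b : nat -> R) (chi eta : R)
    (w z : R[i]) :
  (2 <= k)%N -> polygon_params k a b -> in_polygon k a b chi eta ->
  0 < complex.Im w -> critical_eq k a b chi eta w ->
  0 < complex.Im z -> critical_eq k a b chi eta z -> z = w.
Proof.
move=> hk hab inP imw hw imz /critical_eqE.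
have [rs ->] := critical_polyC_factor hab inP (lt0r_neq0 imw) hw hk.
have eta0 : eta != 0 by case: inP => /andP[/lt0r_neq0].
rewrite rootZ ?fmorph_eq0 // !rootM !root_XsubC => /or3P[/eqP//|/eqP zw|].
  by move: imz; rewrite zw; case: (w) imw => x y /= /lt_trans h;
     rewrite oppr_gt0 => /h; rewrite ltxx.
rewrite -(big_map (real_complex R) predT (fun r => 'X - r%:P)).
rewrite root_prod_XsubC => /mapP[r _ zr].
by move: imz; rewrite zr ltxx.
Qed.

Lemma denominator_neq0 (R : realType) (chi eta : R) (w : R[i]) :
  0 < complex.Im w -> w - chi%:C + 1 - eta%:C != 0.
Proof.
case: w => x y /= y0; apply: contraTneq y0 => /eqP.
by rewrite eq_complex /= !subr0 addr0 => /andP[_ /eqP->]; rewrite ltxx.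
Qed.

Lemma slope_critical_eq (R : realType) (k : nat) (a b : nat -> R)
    (chi eta : R) (w : R[i]) :
  eta < 1 -> w - chi%:C + 1 - eta%:C != 0 ->
  slope_eq k a b chi eta ((w - chi%:C) / (w - chi%:C + 1 - eta%:C)) <->
  critical_eq k a b chi eta w.
Proof.
set m := w - chi%:C + 1 - eta%:C => eta1 m0.
have e1 : 1 - eta%:C != 0 :> R[i].
  by rewrite -(rmorph1 (real_complex R)) -rmorphB fmorph_eq0 subr_eq0 gt_eqF.
(* Each of the [k] factors on either side equals [w - c i] times [(1 - eta) / m], so [K] cancels; it
   is nonzero because [eta < 1]. *)
pose K : R[i] := ((1 - eta%:C) / m) ^+ k.
have K0 : K != 0 by rewrite expf_neq0 // mulf_neq0 // invr_eq0.
have fac (c : nat -> R) :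
    \prod_(1 <= i < k.+1) ((c i - chi + 1 - eta)%:C * ((w - chi%:C) / m) -
                           (c i - chi)%:C) =
    K * \prod_(1 <= i < k.+1) (w - (c i)%:C).
  have -> : K = \prod_(1 <= i < k.+1) ((1 - eta%:C) / m).
    by rewrite prodr_const_nat subSS subn0.
  rewrite -big_split /=.
  apply: eq_bigr => i _; move: m0; rewrite /m => m0.
  by rewrite !(rmorphB, rmorphD, rmorph1); field.
rewrite /slope_eq /critical_eq !fac -/m mulrCA; split=> [/(mulfI K0) h|h].
  by rewrite -h mulrA [m * _]mulrC divfK.
by congr (_ * _); rewrite mulrAC h mulrAC divff ?mul1r.
Qed.

(** The slope is a real Moebius transform of [w] with determinant [1 - eta > 0], which preserves the
    upper half plane. *)
Lemma im_slope_gt0 (R : realType) (chi eta : R) (w : R[i]) :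
  eta < 1 -> 0 < complex.Im w ->
  0 < complex.Im ((w - chi%:C) / (w - chi%:C + 1 - eta%:C)).
Proof.
move=> eta1; case: w => x y /= y0.
rewrite !subr0 !addr0.
set D := (_ ^+ 2 + y ^+ 2).
have -> : (x - chi) * - (y / D) + y * ((x - chi + 1 - eta) / D) =
    y * (1 - eta) / D by ring.
by rewrite divr_gt0 ?mulr_gt0 ?subr_gt0 // ltr_wpDl ?sqr_ge0 ?exprn_gt0.
Qed.

(** * Locating roots and complex limits *)

(** If every root were at distance at least [e] from [w], the factored form would bound the modulus
    of [p.[w]] below by the right-hand side. *)
Lemma poly_root_near (C : numClosedFieldType) (p : {poly C}) (w e : C) :
  0 < e -> `|p.[w]| < `|lead_coef p| * e ^+ (size p).-1 ->
  exists2 z, root p z & `|z - w| < e.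
Proof.
move=> e0 lt_p; have [r def_p] := closed_field_poly_normal p.
have lp0 : lead_coef p != 0.
  by apply: contraTneq lt_p => ->; rewrite normr0 mul0r normr_lt0.
have szr : (size p).-1 = size r.
  by rewrite def_p size_scale // size_prod_XsubC.
have [/hasP[z zr lt_z]|/hasPn far] := boolP (has (fun z => `|z - w| < e) r).
  by exists z; rewrite // def_p rootZ // root_prod_XsubC.
suff : `|lead_coef p| * e ^+ (size p).-1 <= `|p.[w]|.
  by move=> /(lt_le_trans lt_p); rewrite ltxx.
rewrite {3}def_p hornerZ horner_prod normrM ler_wpM2l // normr_prod szr.
elim: r far {def_p szr} => [|z r IH] far; first by rewrite big_nil.
rewrite big_cons exprS ler_pM ?exprn_ge0 ?(ltW e0) //.
  rewrite !hornerE distrC real_leNgt ?normr_real ?gtr0_real //.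
  by apply: far; rewrite mem_head.
by apply: IH => t tr; apply: far; rewrite inE tr orbT.
Qed.

Section ComplexLimits.
Variables (R : realType) (T : Type) (F : set_system T).
Context {FF : Filter F}.
Implicit Types (f g : T -> R[i]) (y z : R[i]).
Local Open Scope classical_set_scope.

(** Limits are taken on real and imaginary parts to match [is_cderive]. *)
Definition ccvg f z : Prop :=
  (complex.Re (f x) @[x --> F] --> complex.Re z) /\
  (complex.Im (f x) @[x --> F] --> complex.Im z).

Lemma ccvg_cst z : ccvg (fun=> z) z.
Proof. by split; apply: cvg_cst. Qed.

Lemma ccvg_real (f : T -> R) (x : R) :
  f t @[t --> F] --> x -> ccvg (fun t => (f t)%:C) x%:C.
Proof. by split => //=; apply: cvg_cst. Qed.

Lemma ccvgD f g y z : ccvg f y -> ccvg g z -> ccvg (fun x => f x + g x) (y + z).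
Proof.
move=> [f1 f2] [g1 g2]; split.
  have -> : complex.Re (y + z) = complex.Re y + complex.Re z.
    by case: (y) (z) => ? ? [].
  rewrite (_ : (fun _ => _) = fun x => complex.Re (f x) + complex.Re (g x)).
    exact: cvgD.
  by apply/funext => x; case: (f x) (g x) => ? ? [].
have -> : complex.Im (y + z) = complex.Im y + complex.Im z.
  by case: (y) (z) => ? ? [].
rewrite (_ : (fun _ => _) = fun x => complex.Im (f x) + complex.Im (g x)).
  exact: cvgD.
by apply/funext => x; case: (f x) (g x) => ? ? [].
Qed.

Lemma ccvgM f g y z : ccvg f y -> ccvg g z -> ccvg (fun x => f x * g x) (y * z).
Proof.
move=> [f1 f2] [g1 g2]; split.
  have -> : complex.Re (y * z) =
      complex.Re y * complex.Re z - complex.Im y * complex.Im z.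
    by case: (y) (z) => ? ? [].
  rewrite (_ : (fun _ => _) = fun x => complex.Re (f x) * complex.Re (g x) -
    complex.Im (f x) * complex.Im (g x)); first by apply: cvgB; apply: cvgM.
  by apply/funext => x; case: (f x) (g x) => ? ? [].
have -> : complex.Im (y * z) =
    complex.Re y * complex.Im z + complex.Im y * complex.Re z.
  by case: (y) (z) => ? ? [].
rewrite (_ : (fun _ => _) = fun x => complex.Re (f x) * complex.Im (g x) +
  complex.Im (f x) * complex.Re (g x)); first by apply: cvgD; apply: cvgM.
by apply/funext => x; case: (f x) (g x) => ? ? [].
Qed.

Lemma ccvgN f y : ccvg f y -> ccvg (fun x => - f x) (- y).
Proof.
move=> fy; rewrite -mulN1r (_ : (fun _ => _) = fun x => -1 * f x).
  exact: (ccvgM (ccvg_cst (-1)) fy).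
by apply/funext => x; rewrite mulN1r.
Qed.

Lemma ccvgB f g y z : ccvg f y -> ccvg g z -> ccvg (fun x => f x - g x) (y - z).
Proof. by move=> fy gz; exact: (ccvgD fy (ccvgN gz)). Qed.

Lemma ccvgV f y : y != 0 -> ccvg f y -> ccvg (fun x => (f x)^-1) y^-1.
Proof.
move=> y0 [f1 f2].
have n0 : complex.Re y ^+ 2 + complex.Im y ^+ 2 != 0.
  case: y y0 {f1 f2} => u v /=; apply: contra; rewrite eq_complex /=.
  by rewrite paddr_eq0 ?sqr_ge0 // !sqrf_eq0.
have cn : (complex.Re (f x) ^+ 2 + complex.Im (f x) ^+ 2)^-1 @[x --> F] -->
    (complex.Re y ^+ 2 + complex.Im y ^+ 2)^-1.
  by apply: cvgV => //; apply: cvgD; rewrite !expr2; apply: cvgM.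
split.
  rewrite (_ : (fun _ => _) = fun x => complex.Re (f x) *
    (complex.Re (f x) ^+ 2 + complex.Im (f x) ^+ 2)^-1); last first.
    by apply/funext => x; case: (f x).
  have -> : complex.Re y^-1 =
    complex.Re y * (complex.Re y ^+ 2 + complex.Im y ^+ 2)^-1 by case: (y).
  exact: cvgM.
rewrite (_ : (fun _ => _) = fun x => - (complex.Im (f x) *
  (complex.Re (f x) ^+ 2 + complex.Im (f x) ^+ 2)^-1)); last first.
  by apply/funext => x; case: (f x).
have -> : complex.Im y^-1 =
  - (complex.Im y * (complex.Re y ^+ 2 + complex.Im y ^+ 2)^-1) by case: (y).
by apply: cvgN; apply: cvgM.
Qed.

Lemma ccvg_horner (p : {poly R[i]}) f y :
  ccvg f y -> ccvg (fun x => p.[f x]) p.[y].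
Proof.
move=> fy; elim/poly_ind: p => [|p c IH].
  rewrite horner0 (_ : (fun _ => _) = fun=> 0); first exact: ccvg_cst.
  by apply/funext => x; rewrite horner0.
rewrite !hornerE (_ : (fun _ => _) = fun x => p.[f x] * f x + c).
  exact: (ccvgD (ccvgM IH fy) (ccvg_cst _)).
by apply/funext => x; rewrite !hornerE.
Qed.

Lemma ccvg_near_eq f g y :
  (\forall x \near F, f x = g x) -> ccvg f y -> ccvg g y.
Proof.
move=> fg [f1 f2]; split.
  by apply: cvg_trans f1; apply: near_eq_cvg; apply: filterS fg => x ->.
by apply: cvg_trans f2; apply: near_eq_cvg; apply: filterS fg => x ->.
Qed.

Lemma ReIm_le_norm z (e : R) : `|z| < e%:C ->
  `|complex.Re z| < e /\ `|complex.Im z| < e.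
Proof.
rewrite normc_def ltcR => lt_e; split; apply: le_lt_trans lt_e;
  rewrite -sqrtr_sqr ler_wsqrtr //.
  by rewrite lerDl sqr_ge0.
by rewrite lerDr sqr_ge0.
Qed.

Lemma ccvg_norm_lt f y :
  (forall e : R, 0 < e -> \forall x \near F, `|f x - y| < e%:C) -> ccvg f y.
Proof.
move=> fy; split; apply/cvgrPdist_lt => e e0; apply: filterS (fy e e0) => x.
  by case: (f x) (y) => p q [r s] /ReIm_le_norm[/= h _]; rewrite distrC.
by case: (f x) (y) => p q [r s] /ReIm_le_norm[/= _ h]; rewrite distrC.
Qed.

Lemma ccvg_neq0 f y : y != 0 -> ccvg f y -> \forall x \near F, f x != 0.
Proof.
move=> y0 [f1 f2].
have [re0|re0] := eqVneq (complex.Re y) 0; last first.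
  by apply: filterS (cvgr_neq0 _ f1 re0) => x; apply: contra => /eqP ->.
have im0 : complex.Im y != 0.
  by move: y0; case: (y) re0 => u v /= ->; rewrite eq_complex /= eqxx.
by apply: filterS (cvgr_neq0 _ f2 im0) => x; apply: contra => /eqP ->.
Qed.

End ComplexLimits.

(** Allows derivatives to be computed with complex difference quotients: multiplying by the real
    number [h^-1] acts on each part separately. *)
Lemma is_cderive_ccvg (R : realType) (f : R -> R[i]) (t : R) (df : R[i]) :
  ccvg ((0 : R)^')%classic (fun h : R => (h^-1)%:C * (f (t + h) - f t)) df ->
  is_cderive f t df.
Proof.
have Rez (x : R) (z : R[i]) : complex.Re (x%:C * z) = x * complex.Re z.
  by case: z => u v /=; rewrite mul0r subr0.
have Imz (x : R) (z : R[i]) : complex.Im (x%:C * z) = x * complex.Im z.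
  by case: z => u v /=; rewrite mul0r addr0.
case=> h1 h2; split.
  have h : ((h : R)^-1 *: (complex.Re (f (h *: 1 + t)) - complex.Re (f t))
      @[h --> (0 : R)^'] --> complex.Re df)%classic.
    apply: cvg_trans h1; apply: near_eq_cvg; apply: nearW => h /=.
    rewrite Rez [h *: _]mulr1 [h + t]addrC; congr (_ * _).
    by case: (f _) (f t) => ? ? [].
  by apply: DeriveDef; [apply/cvg_ex; exists (complex.Re df)|apply: cvg_lim].
have h : ((h : R)^-1 *: (complex.Im (f (h *: 1 + t)) - complex.Im (f t))
    @[h --> (0 : R)^'] --> complex.Im df)%classic.
  apply: cvg_trans h2; apply: near_eq_cvg; apply: nearW => h /=.
  rewrite Imz [h *: _]mulr1 [h + t]addrC; congr (_ * _).
  by case: (f _) (f t) => ? ? [].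
by apply: DeriveDef; [apply/cvg_ex; exists (complex.Im df)|apply: cvg_lim].
Qed.

Lemma ccvg_near_norm (R : realType) (T : Type) (F : set_system T)
    {FF : Filter F} (f : T -> R[i]) (y : R[i]) (e : R) :
  0 < e -> ccvg F f y -> \forall x \near F, `|f x - y| < e%:C.
Proof.
move=> e0 [/cvgrPdist_lt f1 /cvgrPdist_lt f2].
have e2 : 0 < e / 2 by rewrite divr_gt0.
apply: filterS2 (f1 _ e2) (f2 _ e2) => x h1 h2.
have -> : f x - y = (complex.Re (f x) - complex.Re y)%:C +
    'i%C * (complex.Im (f x) - complex.Im y)%:C.
  rewrite [in LHS](complexE (f x)) [in LHS](complexE y) !rmorphB; ring.
apply: le_lt_trans (ler_normD _ _) _.
have norm_real (r : R) : `|r%:C| = `|r|%:C.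
  by rewrite normc_def /= expr0n addr0 sqrtr_sqr.
have -> : `|'i%C * (complex.Im (f x) - complex.Im y)%:C| =
    `|complex.Im (f x) - complex.Im y|%:C.
  by rewrite normrM normc_def /= expr0n expr1n add0r sqrtr1 mul1r norm_real.
by rewrite norm_real -rmorphD ltcR [ltRHS]splitr ltrD // distrC.
Qed.

(** * Stability of the critical root under moving parameters *)

Section MovingParameters.
Variables (R : realType) (k : nat) (a b : nat -> R).
Hypotheses (hk : (2 <= k)%N) (hab : polygon_params k a b).
Variables (T : Type) (F : set_system T).
Context {FF : Filter F}.
Variables (x y : T -> R) (chi eta : R).
Local Open Scope classical_set_scope.
Hypotheses (cvgx : x t @[t --> F] --> chi) (cvgy : y t @[t --> F] --> eta).

(** Avoiding a closed cut means one of two strict inequalities, [chi + eta < a i + 1] or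
    [b i < chi]. All conditions are thus open and finite in number; the induction on [n] intersects
    those of the cuts. *)
Lemma in_polygon_near : in_polygon k a b chi eta ->
  \forall t \near F, in_polygon k a b (x t) (y t).
Proof.
case=> /andP[eta0 eta1] /andP[lt_a lt_b] out.
have cvgxy : x t + y t @[t --> F] --> chi + eta by exact: cvgD.
have out_near n : (n <= k)%N -> \forall t \near F, forall i, (1 <= i <= n)%N ->
    x t + y t < a i + 1 \/ b i < x t.
  elim: n => [|n IH] nk.
    by apply: nearW => t i /andP[i1]; rewrite leqn0 => /eqP i0; rewrite i0 in i1.
  have outn : \forall t \near F, x t + y t < a n.+1 + 1 \/ b n.+1 < x t.
    have [lt_n|le_n] := ltP (b n.+1) chi.
      by apply: filterS (cvgr_gt _ cvgx _ lt_n) => t; right.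
    have lt_an : chi + eta < a n.+1 + 1.
      rewrite ltNge; apply/negP => le_an; apply: out; exists n.+1.
      by rewrite nk le_n andbT; split=> //; lra.
    by apply: filterS (cvgr_lt _ cvgxy _ lt_an) => t; left.
  apply: filterS2 outn (IH (ltnW nk)) => t hn hlt i /andP[i1].
  by rewrite leq_eqVlt => /predU1P[->//|lt_in]; apply: hlt; rewrite i1.
have lt_a' : a 1%N + 1 < chi + eta by lra.
apply: filterS (filterI
    (filterI (cvgr_gt _ cvgy _ eta0) (cvgr_lt _ cvgy _ eta1))
    (filterI (filterI (cvgr_gt _ cvgxy _ lt_a') (cvgr_lt _ cvgx _ lt_b))
      (out_near k (leqnn k)))) => t [[y0 y1] [[lt_at lt_bt] out_t]].
split.
- by rewrite y0.
- by rewrite lt_bt andbT; lra.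
- by case=> i [ik /andP[h1 h2]]; case: (out_t i ik); lra.
Qed.

Lemma critical_root_near (w : R[i]) (e : R) : 0 < e -> 0 < eta ->
  critical_eq k a b chi eta w ->
  \forall t \near F,
    exists2 z, critical_eq k a b (x t) (y t) z & `|z - w| < e%:C.
Proof.
move=> e0 eta0 hw.
have eta0C : eta%:C != 0 by rewrite fmorph_eq0 gt_eqF.
(* Dividing by the moving leading coefficient [y t] reduces the bound of [poly_root_near] to the
   fixed threshold [e ^+ k]. *)
have cvg0 : ccvg F (fun t => (map_poly (real_complex R)
    (critical_poly k a b (x t) (y t))).[w] / (y t)%:C) 0.
  have -> : 0 = ((w - chi%:C) * \prod_(1 <= i < k.+1) (w - (a i)%:C) -
     (w - chi%:C + 1 - eta%:C) * \prod_(1 <= i < k.+1) (w - (b i)%:C)) / eta%:C.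
    by rewrite hw subrr mul0r.
  apply: ccvgM; last by apply: ccvgV => //; apply: ccvg_real.
  rewrite (_ : (fun t => _) = fun t =>
     (w - (x t)%:C) * \prod_(1 <= i < k.+1) (w - (a i)%:C) -
     (w - (x t)%:C + 1 - (y t)%:C) * \prod_(1 <= i < k.+1) (w - (b i)%:C));
    last by apply/funext => t; rewrite horner_critical_polyC.
  have cx : ccvg F (fun t => w - (x t)%:C) (w - chi%:C).
    by apply: ccvgB; [exact: ccvg_cst|exact: ccvg_real].
  apply: ccvgB; apply: ccvgM => //; try exact: ccvg_cst.
  apply: ccvgB; last exact: ccvg_real.
  by apply: ccvgD; last exact: ccvg_cst.
have ek : 0 < e ^+ k by rewrite exprn_gt0.
apply: filterS2 (ccvg_near_norm ek cvg0) (cvgr_gt _ cvgy _ eta0) => t.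
rewrite subr0 => small y0.
have [sz lc] := size_lead_coef_critical_poly hab (x t) (lt0r_neq0 y0).
have y0C : 0 < `|(y t)%:C| by rewrite normr_gt0 fmorph_eq0 gt_eqF.
have [||z rz lt_z] := @poly_root_near _ (map_poly (real_complex R)
    (critical_poly k a b (x t) (y t))) w e%:C.
- by rewrite (ltcR 0).
- rewrite lead_coef_map lc size_map_poly sz -rmorphXn /= mulrC.
  by rewrite -ltr_pdivrMr // -normf_div.
by exists z => //; apply/critical_eqE.
Qed.

(** A root closer to [w] than [complex.Im w] is still in the upper half plane. It therefore
    witnesses that the moved point is liquid, and by uniqueness it is [W t]. *)
Lemma critical_root_cvg (w : R[i]) (W : T -> R[i]) :
  in_polygon k a b chi eta -> 0 < complex.Im w ->
  critical_eq k a b chi eta w ->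
  (forall t, liquid k a b (x t) (y t) ->
     0 < complex.Im (W t) /\ critical_eq k a b (x t) (y t) (W t)) ->
  (\forall t \near F, liquid k a b (x t) (y t)) /\ ccvg F W w.
Proof.
move=> inP imw hw hW.
have eta0 : 0 < eta by case: inP => /andP[].
have near_root e : 0 < e -> e <= complex.Im w -> \forall t \near F,
    liquid k a b (x t) (y t) /\ `|W t - w| < e%:C.
  move=> e0 le_e.
  apply: filterS2 (in_polygon_near inP) (critical_root_near e0 eta0 hw).
  move=> t inPt [z hz lt_z].
  have imz : 0 < complex.Im z.
    have [_] := ReIm_le_norm lt_z.
    case: (z) (w) le_e => p q [r s] /= le_e.
    by rewrite ltr_norml => /andP[h _]; lra.
  have liqt : liquid k a b (x t) (y t).
    by split=> //; exists z; rewrite lt0r_neq0.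
  have [imW critW] := hW t liqt.
  by rewrite -(critical_eq_uniq hk hab inPt imW critW imz hz).
split; first by apply: filterS (near_root _ imw (lexx _)) => t [].
apply: ccvg_norm_lt => e e0.
(* The radius is capped by [complex.Im w] so that [near_root] applies. *)
have m0 : 0 < Num.min e (complex.Im w) by rewrite lt_min e0.
have le_m : Num.min e (complex.Im w) <= complex.Im w.
  by rewrite ge_min lexx orbT.
apply: filterS (near_root _ m0 le_m) => t [_ /lt_le_trans]; apply.
by rewrite lecR ge_min lexx.
Qed.

End MovingParameters.

(** * Differentiating the slope *)

(** Simplicity is phrased through the cofactor [q], whose value at the moving root is the
    denominator of the difference quotient of that root. *)
Lemma critical_polyC_simple_root (R : realType) (k : nat) (a b : nat -> R)
    (chi eta : R) (w : R[i]) :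
  (2 <= k)%N -> polygon_params k a b -> in_polygon k a b chi eta ->
  0 < complex.Im w -> critical_eq k a b chi eta w ->
  exists2 q : {poly R[i]},
    map_poly (real_complex R) (critical_poly k a b chi eta) =
      ('X - w%:P) * q & q.[w] != 0.
Proof.
move=> hk hab inP imw hw.
have [rs def_p] := critical_polyC_factor hab inP (lt0r_neq0 imw) hw hk.
exists (eta%:C *: (('X - (conjc w)%:P) * \prod_(r <- rs) ('X - (r%:C)%:P))).
  by rewrite def_p scalerAr.
have eta0 : eta != 0 by case: inP => /andP[/lt0r_neq0].
rewrite hornerZ mulf_neq0 ?fmorph_eq0 // hornerM mulf_neq0 //.
  rewrite !hornerE; case: (w) imw => p q /= q0.
  by rewrite eq_complex /= opprK negb_and (gt_eqF (addr_gt0 q0 q0)) orbT.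
rewrite horner_prod prodf_seq_neq0; apply/allP => r _ /=; rewrite !hornerE.
case: (w) imw => p q /= q0.
by rewrite eq_complex /= subr0 negb_and (gt_eqF q0) orbT.
Qed.

(** Implicit differentiation along the direction [(u, v)], followed by the quotient rule; the
    directions [(1, 0)] and [(0, 1)] give the two partial derivatives. *)
Lemma slope_directional_derivative (R : realType) (k : nat) (a b : nat -> R)
    (chi eta u v : R) (w : R[i]) (q : {poly R[i]}) (Om : R -> R[i]) :
  let A := \prod_(1 <= i < k.+1) (w - (a i)%:C) in
  let B := \prod_(1 <= i < k.+1) (w - (b i)%:C) in
  let n := w - chi%:C in let m := w - chi%:C + 1 - eta%:C in
  (2 <= k)%N -> polygon_params k a b -> in_polygon k a b chi eta ->
  0 < complex.Im w -> critical_eq k a b chi eta w ->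
  map_poly (real_complex R) (critical_poly k a b chi eta) =
    ('X - w%:P) * q -> q.[w] != 0 ->
  (forall h, liquid k a b (chi + h * u) (eta + h * v) ->
     exists w', [/\ 0 < complex.Im w',
       critical_eq k a b (chi + h * u) (eta + h * v) w' &
       Om h = (w' - (chi + h * u)%:C) /
              (w' - (chi + h * u)%:C + 1 - (eta + h * v)%:C)]) ->
  ccvg ((0 : R)^')%classic (fun h => (h^-1)%:C * (Om h - n / m))
    ((((u%:C * A - (u + v)%:C * B) / q.[w] - u%:C) * (1 - eta%:C) + n * v%:C) /
     (m * m)).
Proof.
move=> A B n m hk hab inP imw hw def_q qw0 hOm.
(* Choice turns the roots behind [Om] into a function of [h], with default 0 off the liquid
   region. *)
have [W hW] : exists W : R -> R[i], forall h,
    liquid k a b (chi + h * u) (eta + h * v) -> [/\ 0 < complex.Im (W h),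
       critical_eq k a b (chi + h * u) (eta + h * v) (W h) &
       Om h = (W h - (chi + h * u)%:C) /
              (W h - (chi + h * u)%:C + 1 - (eta + h * v)%:C)].
  suff /choice[W hW] : forall h, exists z : R[i],
    liquid k a b (chi + h * u) (eta + h * v) -> [/\ 0 < complex.Im z,
       critical_eq k a b (chi + h * u) (eta + h * v) z &
       Om h = (z - (chi + h * u)%:C) /
              (z - (chi + h * u)%:C + 1 - (eta + h * v)%:C)] by exists W.
  move=> h.
  case: (pselect (liquid k a b (chi + h * u) (eta + h * v))) => [/hOm[z hz]|nliq].
    by exists z.
  by exists 0.
have cvgid : (h @[h --> (0 : R)^'] --> (0 : R))%classic.
  exact: cvg_within_filter.
have cvgl (c s : R) : (c + h * s @[h --> (0 : R)^'] --> c)%classic.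
  rewrite -[X in (_ --> X)%classic]addr0 -[X in (_ --> _ + X)%classic](mul0r s).
  by apply: cvgD; [exact: cvg_cst|apply: cvgMl].
have [near_liq cvgW] := critical_root_cvg hk hab (cvgl chi u) (cvgl eta v)
  inP imw hw (fun h liq => let: And3 h1 h2 _ := hW h liq in conj h1 h2).
have m0 : m != 0 by exact: denominator_neq0.
pose PA : {poly R[i]} := \prod_(1 <= i < k.+1) ('X - (a i)%:C%:P).
pose PB : {poly R[i]} := \prod_(1 <= i < k.+1) ('X - (b i)%:C%:P).
have PAE z : PA.[z] = \prod_(1 <= i < k.+1) (z - (a i)%:C).
  by rewrite horner_prod; apply: eq_bigr => i _; rewrite !hornerE.
have PBE z : PB.[z] = \prod_(1 <= i < k.+1) (z - (b i)%:C).
  by rewrite horner_prod; apply: eq_bigr => i _; rewrite !hornerE.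
(* For small nonzero [h] this is the difference quotient of [W], as [defW] shows below; in this form
   it depends continuously on [W h]. *)
pose V h := (u%:C * PA.[W h] - (u + v)%:C * PB.[W h]) / q.[W h].
have cvgV : ccvg ((0 : R)^')%classic V ((u%:C * A - (u + v)%:C * B) / q.[w]).
  rewrite /A /B -PAE -PBE.
  apply: ccvgM; last by apply: ccvgV => //; apply: ccvg_horner.
  by apply: ccvgB; apply: ccvgM; [exact: ccvg_cst|exact: ccvg_horner|
    exact: ccvg_cst|exact: ccvg_horner].
pose M h := W h - (chi + h * u)%:C + 1 - (eta + h * v)%:C.
have cvgM : ccvg ((0 : R)^')%classic M m.
  apply: ccvgB; last exact: ccvg_real.
  apply: ccvgD; last exact: ccvg_cst.
  by apply: ccvgB => //; apply: ccvg_real.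
have near_q : \forall h \near ((0 : R)^')%classic, q.[W h] != 0.
  by apply: ccvg_neq0 qw0 _; apply: ccvg_horner.
(* The difference quotient of [Om] with [h] cancelled: the numerator of the slope moves by
   [h * (V h - u)], its denominator by [h * (V h - u - v)], and [m - n = 1 - eta]. *)
pose D h := ((V h - u%:C) * (1 - eta%:C) + n * v%:C) / (M h * m).
apply: (@ccvg_near_eq _ _ _ _ D); last first.
  apply: ccvgM; last first.
    by apply: ccvgV; [rewrite mulf_neq0|apply: ccvgM => //; apply: ccvg_cst].
  apply: ccvgD; last exact: ccvg_cst.
  apply: ccvgM; last exact: ccvg_cst.
  by apply: ccvgB => //; apply: ccvg_cst.
have near0 : \forall h \near ((0 : R)^')%classic, h != 0.
  exact: nbhs_dnbhs_neq.
near=> h.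
have h0 : h != 0. near: h; exact: near0.
have liq : liquid k a b (chi + h * u) (eta + h * v). near: h. exact: near_liq.
have qW0 : q.[W h] != 0. near: h. exact: near_q.
have [imW critW ->] := hW h liq.
have Mh0 : M h != 0 by exact: denominator_neq0.
rewrite /D -/(M h).
have h0C : h%:C != 0 by rewrite fmorph_eq0.
have defW : W h = w + h%:C * V h.
  have : (map_poly (real_complex R) (critical_poly k a b chi eta)).[W h] =
      (W h - w) * q.[W h] by rewrite def_q hornerM !hornerE.
  rewrite horner_critical_polyC -PAE -PBE => eq1.
  move: critW; rewrite /critical_eq -PAE -PBE => eq2.
  (* The old polynomial at [W h] is compared with the perturbed one, which vanishes there; their
     difference is linear in [h]. *)
  have eq3 : (W h - w) * q.[W h] =
      h%:C * (u%:C * PA.[W h] - (u + v)%:C * PB.[W h]).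
    rewrite -eq1; apply/eqP; rewrite -subr_eq0; apply/eqP.
    rewrite -[RHS](subrr ((W h - (chi + h * u)%:C) * PA.[W h])) {2}eq2.
    rewrite !(rmorphD, rmorphM) /=; ring.
  by apply/eqP; rewrite addrC -subr_eq /V mulrA -eq3 mulfK.
have -> : (W h - (chi + h * u)%:C) / M h - n / m =
   ((W h - (chi + h * u)%:C) * m - n * M h) / (M h * m).
  by field; rewrite m0 Mh0.
rewrite mulrA fmorphV; congr (_ / _).
apply: (mulfI h0C); rewrite mulrA divff // mul1r.
rewrite /M /m /n defW !(rmorphD, rmorphM) /=; ring.
Unshelve. all: by end_near.
Qed.

(** * The slope equation and the complex Burgers equation *)

Theorem proposition2p5 (R : realType) (k : nat) (a b : nat -> R)
    (d d' : nat -> nat -> int) (Omega : R -> R -> R[i])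
    (hk : (2 <= k)%N)
    (hab : polygon_params k a b)
    (hd : valid_rounding k a b d d')
    (* Omega is the complex slope in the liquid region *)
    (hOmega : forall chi eta : R, liquid k a b chi eta ->
       complex_slope k a b d d' chi eta (Omega chi eta))
    (* the known expression of the slope in the liquid region *)
    (hslope : forall (chi eta : R) (z : R[i]), liquid k a b chi eta ->
       complex_slope k a b d d' chi eta z ->
       exists w : R[i],
         [/\ 0 < complex.Im w, critical_eq k a b chi eta w
           & z = (w - chi%:C) / (w - chi%:C + 1 - eta%:C)]) :
  forall chi eta : R, liquid k a b chi eta ->
    [/\ 0 < complex.Im (Omega chi eta),
        slope_eq k a b chi eta (Omega chi eta),
        forall z : R[i], 0 < complex.Im z -> slope_eq k a b chi eta z ->
          z = Omega chi eta
      & exists dchi deta : R[i],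
          [/\ is_cderive (fun t => Omega t eta) chi dchi,
              is_cderive (fun t => Omega chi t) eta deta
            & Omega chi eta * dchi = - (1 - Omega chi eta) * deta]].
Proof.
have hO chi eta : liquid k a b chi eta -> exists w : R[i],
    [/\ 0 < complex.Im w, critical_eq k a b chi eta w
      & Omega chi eta = (w - chi%:C) / (w - chi%:C + 1 - eta%:C)].
  by move=> liq; apply: hslope => //; apply: hOmega.
move=> chi eta liq; have [inP _] := liq.
have [w [imw hw defO]] := hO chi eta liq.
have eta1 : eta < 1 by case: inP => /andP[].
have m0 := denominator_neq0 chi eta imw.
have e1 : 0 < 1 - eta by rewrite subr_gt0.
split.
- by rewrite defO im_slope_gt0.
- by rewrite defO; apply/slope_critical_eq.
- move=> z imz hz.
  have z1 : 1 - z != 0.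
    case: (z) imz => p r /= r0.
    by rewrite eq_complex /= sub0r oppr_eq0 negb_and (gt_eqF r0) orbT.
  have e1C : 1 - eta%:C != 0 :> R[i].
    by rewrite -(rmorph1 (real_complex R)) -rmorphB fmorph_eq0 gt_eqF.
  (* The inverse Moebius map sends the solution [z] back to a critical root, still in the upper half
     plane, where uniqueness is known. *)
  pose w' := chi%:C + (1 - eta%:C) * z / (1 - z).
  have imw' : 0 < complex.Im w'.
    rewrite /w'; case: (z) imz => p r /= r0.
    set D := (_ ^+ 2 + _ ^+ 2).
    rewrite (_ : _ + _ = (1 - eta) * r / D); last by ring.
    by rewrite divr_gt0 ?mulr_gt0 // ltr_wpDl ?sqr_ge0 // sub0r sqrrN exprn_gt0.
  have zE : z = (w' - chi%:C) / (w' - chi%:C + 1 - eta%:C).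
    have -> : w' - chi%:C + 1 - eta%:C = (1 - eta%:C) / (1 - z).
      by rewrite /w'; field.
    by rewrite /w'; field; rewrite z1.
  have hw' : critical_eq k a b chi eta w'.
    apply/(slope_critical_eq _ _ _ eta1 (denominator_neq0 chi eta imw')).
    by rewrite -zE.
  by rewrite zE defO (critical_eq_uniq hk hab inP imw hw imw' hw').
have [q def_q qw0] := critical_polyC_simple_root hk hab inP imw hw.
do 2 eexists; split.
- apply: is_cderive_ccvg; rewrite defO.
  apply: (@slope_directional_derivative _ k a b chi eta 1 0 w q) => // h.
  by rewrite mulr1 mulr0 addr0; apply: hO.
- apply: is_cderive_ccvg; rewrite defO.
  apply: (@slope_directional_derivative _ k a b chi eta 0 1 w q) => // h.
  by rewrite mulr1 mulr0 addr0; apply: hO.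
have n0 : w - chi%:C != 0.
  case: (w) imw => p r /= r0.
  by rewrite eq_complex /= subr0 negb_and (gt_eqF r0) orbT.
set n := w - chi%:C in n0 *; set m := n + 1 - eta%:C in m0 *.
move: hw; rewrite /critical_eq -/n -/m defO -/n -/m.
set A := \prod_(_ <= _ < _) (_ - (a _)%:C); set B := \prod_(_ <= _ < _) _ => hw.
(* The critical equation [n * A = m * B] eliminates [A]; once [1 - eta] is written as [m - n], the
   Burgers equation is a rational identity in [n], [m], [B] and [q.[w]]. *)
have -> : A = m * B / n by rewrite -hw mulrAC divff ?mul1r.
have -> : 1 - eta%:C = m - n by rewrite /m; ring.
rewrite addr0 add0r rmorph0 rmorph1.
by field; rewrite qw0 n0 m0.
Qed.
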